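(* Let $0\le k_-<k_+<\infty$, let $L\in\mathbb{N}$, and let $\Gamma_L=\{x_1,\dots,x_L\}\subset\mathbb{R}^2$ be a set of $L$ distinct points (sensors), no three of which are collinear. Consider point-source configurations in $\mathbb{R}^2$ consisting of $M\ge 1$ sources at distinct positions $z_1,\dots,z_M\in\mathbb{R}^2\setminus\Gamma_L$ with scattering strengths $\tau_1,\dots,\tau_M\in\mathbb{C}\setminus\{0\}$, where $L\ge 4M-1$. Then the number $M$, the positions $z_1,\dots,z_M$ and the scattering strengths $\tau_1,\dots,\tau_M$ are uniquely determined by the scattered fields $u^s(x,k)$ for all $x\in\Gamma_L$ and all $k\in(k_-,k_+)$. That is: if $(M;z_1,\dots,z_M;\tau_1,\dots,\tau_M)$ and $(M';z_1',\dots,z_{M'}';\tau_1',\dots,\tau_{M'}')$ are two such configurations (so $L\ge 4M-1$ and $L\ge 4M'-1$) whose scattered fields coincide at all $x\in\Gamma_L$ and all $k\in(k_-,k_+)$, then $M=M'$ and there is a permutation $\sigma$ of $\{1,\dots,M\}$ with $z_m'=z_{\sigma(m)}$ and $\tau_m'=\tau_{\sigma(m)}$ for all $m$.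
   Context: For wave number $k>0$, the scattered field in $\mathbb{R}^2$ of a configuration of $M$ point sources at positions $z_m$ with strengths $\tau_m$ is $$u^s(x,k)=\sum_{m=1}^M\tau_m\Phi_k(x,z_m),\qquad x\in\mathbb{R}^2\setminus\{z_1,\dots,z_M\},$$ where $$\Phi_k(x,y)=\frac{i}{8k^2}\left(H_0^{(1)}(k|x-y|)+\frac{2i}{\pi}K_0(k|x-y|)\right),\qquad x\ne y,$$ $H_0^{(1)}=J_0+iY_0$ is the Hankel function of the first kind of order $0$ ($J_0$, $Y_0$ the Bessel and Neumann functions of order $0$), and $K_0$ is the Macdonald function (modified Bessel function of the second kind) of order $0$. This $u^s$ is the solution of the biharmonic wave equation $\Delta^2u^s-k^4u^s=\sum_{m=1}^M\tau_m\delta_{z_m}$ in $\mathbb{R}^2$, with $\delta_{z}$ the Dirac measure at $z$, satisfying the radiation condition $\partial_r w-ikw=o(r^{-1/2})$ as $r=|x|\to\infty$ for $w=u^s$ and $w=\Delta u^s$. *)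

(* Defs.v *)
From mathcomp Require Import all_boot all_order all_algebra all_fingroup.
From mathcomp Require Import all_classical all_reals all_analysis.
From mathcomp Require Import complex.

Set Implicit Arguments.
Unset Strict Implicit.
Unset Printing Implicit Defensive.

Import Order.TTheory GRing.Theory Num.Theory.
Import numFieldNormedType.Exports.

Local Open Scope ring_scope.
Local Open Scope complex_scope.

Section bessel.
Variable R : realType.
Implicit Types x : R.

(* Euler-Mascheroni constant; series harmonic n = 1 + 1/2 + ... + 1/n. *)
Definition euler_gamma : R :=
  limn (fun n : nat => series harmonic n - ln n%:R).

(* Ascending series of the cylinder functions of order 0 at x > 0
   (DLMF 10.2.2, 10.25.2, 10.8.2 and 10.31.2), as power series in (x/2)^2. *)
Definition besselJ0 x : R :=
  limn (pseries (fun n => (-1) ^+ n / n`!%:R ^+ 2) ((x / 2) ^+ 2)).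

Definition besselI0 x : R :=
  limn (pseries (fun n => (n`!%:R ^+ 2)^-1) ((x / 2) ^+ 2)).

Definition besselY0 x : R :=
  2 / pi * ((ln (x / 2) + euler_gamma) * besselJ0 x +
    limn (pseries (fun n => (-1) ^+ n.+1 * series harmonic n / n`!%:R ^+ 2)
                  ((x / 2) ^+ 2))).

Definition besselK0 x : R :=
  - (ln (x / 2) + euler_gamma) * besselI0 x +
    limn (pseries (fun n => series harmonic n / n`!%:R ^+ 2) ((x / 2) ^+ 2)).

Definition hankel0 x : R[i] := (besselJ0 x)%:C + 'i%C * (besselY0 x)%:C.

End bessel.

Section biharmonic.
Variable R : realType.
Implicit Types (k : R) (x y : 'rV[R]_2).

(* Euclidean distance; the library norm on 'rV[R]_2 is the sup norm. *)
Definition edist x y : R := Num.sqrt (\sum_(i < 2) (x 0 i - y 0 i) ^+ 2).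

Definition Phi k x y : R[i] :=
  'i%C / (8 * k ^+ 2)%:C *
    (hankel0 (k * edist x y)
     + (2 * 'i%C) / pi%:C * (besselK0 (k * edist x y))%:C).

Definition scattered (M : nat) (z : 'I_M -> 'rV[R]_2) (tau : 'I_M -> R[i]) x k
    : R[i] :=
  \sum_(m < M) tau m * Phi k x (z m).

Definition on_line (a v x : 'rV[R]_2) : Prop := exists t : R, x = a + t *: v.

Definition collinear3 (p q r : 'rV[R]_2) : Prop :=
  exists a v : 'rV[R]_2, [/\ v != 0, on_line a v p, on_line a v q & on_line a v r].

Definition no_three_collinear (L : nat) (x : 'I_L -> 'rV[R]_2) : Prop :=
  forall i j l : 'I_L, i != j -> j != l -> i != l ->
    ~ collinear3 (x i) (x j) (x l).

Definition source_config (L : nat) (x : 'I_L -> 'rV[R]_2)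
    (M : nat) (z : 'I_M -> 'rV[R]_2) (tau : 'I_M -> R[i]) : Prop :=
  [/\ (1 <= M)%N,
      injective z,
      forall (m : 'I_M) (l : 'I_L), z m != x l,
      forall m : 'I_M, tau m != 0 &
      (4 * M - 1 <= L)%N].

End biharmonic.

(* Main.v *)
Require Import Defs.
From mathcomp Require Import all_boot all_order all_algebra all_fingroup.
From mathcomp Require Import all_classical all_reals all_analysis.
From mathcomp Require Import complex ring lra zify.

Set Implicit Arguments.
Unset Strict Implicit.
Unset Printing Implicit Defensive.

Import Order.TTheory GRing.Theory Num.Theory.
Import numFieldNormedType.Exports.

Local Open Scope ring_scope.
Local Open Scope complex_scope.

(* Fix a sensor and subtract the two fields. As functions of v = k^2, the
   components J0(kd), Y0(kd) and K0(kd) coming from a source at distance d are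
   eigenfunctions of h |-> (v h')' with eigenvalues -d^2/4, -d^2/4 and d^2/4.
   Eigenfunctions with different eigenvalues are independent on any interval, so
   the data at one sensor separate the distances; as J0 does not vanish
   identically on an interval, the strengths at each distance from the sensor
   sum to 0. If the strengths at some point q did not cancel, every sensor would
   then be equidistant from q and from one of the at most M + M' - 1 other
   sources, hence lie on one of M + M' - 1 bisectors, each of which carries at
   most two sensors; this contradicts L >= 4M - 1 and L >= 4M' - 1. *)

(** * Derivatives of functions of one real variable *)

Lemma is_derive_bigsum (R : realType) (I : Type) (r : seq I) (h : I -> R -> R)
    (dh : I -> R) (v : R) :
  (forall i, is_derive v 1 (h i) (dh i)) ->
  is_derive v 1 (fun u => \sum_(i <- r) h i u) (\sum_(i <- r) dh i).
Proof.
move=> hd; elim: r => [|i r IH].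
  rewrite big_nil (_ : (fun _ => _) = cst 0); first exact: is_derive_cst.
  by apply/funext => u; rewrite big_nil.
rewrite big_cons (_ : (fun _ => _) = h i + fun u => \sum_(j <- r) h j u).
  exact: is_deriveD.
by apply/funext => u; rewrite big_cons.
Qed.

Lemma is_derive1_mul (R : realType) (f g : R -> R) (v df dg : R) :
  is_derive v 1 f df -> is_derive v 1 g dg ->
  is_derive v 1 (fun u => f u * g u) (f v * dg + g v * df).
Proof. exact: is_deriveM. Qed.

Lemma is_derive1_scale (R : realType) (h : R -> R) (c v dh : R) :
  is_derive (c * v) 1 h dh -> is_derive v 1 (fun u => h (c * u)) (c * dh).
Proof.
move=> hd; have hc : is_derive v 1 (fun u : R => c * u) c.
  by apply: is_derive_eq (is_deriveZ c (is_derive_id v 1)) _; rewrite scaler1.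
by rewrite mulrC; apply: (is_derive1_comp hd hc).
Qed.

Lemma is_derive_eq0_itv (R : realType) (a b : R) (h : R -> R) (v d : R) :
  (forall u, a < u < b -> h u = 0) -> a < v < b -> is_derive v 1 h d -> d = 0.
Proof.
move=> h0 hv hd.
have h0d : is_derive v 1 (cst 0 : R -> R) d.
  apply: near_eq_is_derive hd.
  have : \forall u \near v, u \in `]a, b[ by apply: near_in_itvoo; rewrite in_itv.
  by apply: filterS => u; rewrite in_itv /= => /h0 ->.
by rewrite -(derive_val (is_derive := h0d)) derive_cst.
Qed.

(** * Eigenfunctions of h |-> (v h')' and their independence *)

(* [h] solves [(v h')' = lam h] on the interval, with flux [w = v h']. *)
Definition eigenfun (R : realType) (a b lam : R) (h : R -> R) : Prop :=
  exists w : R -> R, forall v, a < v < b ->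
    is_derive v 1 h (w v / v) /\ is_derive v 1 w (lam * h v).

Lemma eigenfunZ (R : realType) (a b lam c : R) (h : R -> R) :
  eigenfun a b lam h -> eigenfun a b lam (fun v => c * h v).
Proof.
move=> [w hw]; exists (fun v => c * w v) => v /hw[h1 h2]; split.
  by rewrite -mulrA; apply: is_deriveZ h1.
by rewrite mulrCA; apply: is_deriveZ h2.
Qed.

Lemma eigenfunD (R : realType) (a b lam : R) (h1 h2 : R -> R) :
  eigenfun a b lam h1 -> eigenfun a b lam h2 ->
  eigenfun a b lam (fun v => h1 v + h2 v).
Proof.
move=> [w1 hw1] [w2 hw2]; exists (fun v => w1 v + w2 v) => v hv.
have [h11 h12] := hw1 _ hv; have [h21 h22] := hw2 _ hv; split.
  by rewrite mulrDl; apply: is_deriveD.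
by rewrite mulrDr; apply: is_deriveD.
Qed.

(** Used with [c = (d / 2) ^ 2]: passing from s = (k d / 2)^2 to v = k^2 moves the distance d into
    the eigenvalue. *)
Lemma eigenfun_scale (R : realType) (a b lam c : R) (h : R -> R) :
  0 < c -> eigenfun (c * a) (c * b) lam h ->
  eigenfun a b (c * lam) (fun v => h (c * v)).
Proof.
move=> c0 [w hw]; exists (fun v => w (c * v)) => v hv.
have [|h1 h2] := hw (c * v); first by rewrite !ltr_pM2l.
split; last by rewrite -mulrA; exact: is_derive1_scale.
apply: is_derive_eq (is_derive1_scale h1) _.
by rewrite invfM mulrCA; congr (_ * _); rewrite mulrA divff ?mul1r// gt_eqF.
Qed.

(** Differentiating the vanishing sum gives the sum of the fluxes divided by [v > 0], so the fluxes
    also sum to 0; differentiating these brings out the eigenvalues. *)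
Lemma eigenfun_sum0 (R : realType) (a b : R) (I : finType) (lam : I -> R)
    (h : I -> R -> R) :
  0 <= a -> (forall i, eigenfun a b (lam i) (h i)) ->
  (forall v, a < v < b -> \sum_i h i v = 0) ->
  forall v, a < v < b -> \sum_i lam i * h i v = 0.
Proof.
move=> a0 /choice[w hw] h0.
have w0 v : a < v < b -> \sum_i w i v = 0.
  move=> hv; have := is_derive_bigsum (index_enum I) (fun i => (hw i v hv).1).
  move/(is_derive_eq0_itv h0 hv); rewrite -mulr_suml => /eqP.
  case/andP: hv => av _; rewrite mulf_eq0 invr_eq0.
  by rewrite [v == 0]gt_eqF ?orbF ?(le_lt_trans a0)// => /eqP.
move=> v hv; have := is_derive_bigsum (index_enum I) (fun i => (hw i v hv).2).
exact: is_derive_eq0_itv w0 hv.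
Qed.

(** Iterating [eigenfun_sum0] makes the sum vanish with weights [lam i ^+ n], hence with weights
    [p.[lam i]] for every polynomial [p]. A [p] that kills all eigenvalues except [mu] isolates the
    wanted group. *)
Lemma eigenfun_indep (R : realType) (a b : R) (I : finType) (lam : I -> R)
    (h : I -> R -> R) :
  0 <= a -> (forall i, eigenfun a b (lam i) (h i)) ->
  (forall v, a < v < b -> \sum_i h i v = 0) ->
  forall mu v, a < v < b -> \sum_(i | lam i == mu) h i v = 0.
Proof.
move=> a0 he h0 mu v hv.
have pow0 n : \sum_i lam i ^+ n * h i v = 0.
  elim: n h he h0 => [|n IH] h he h0.
    by under eq_bigr do rewrite expr0 mul1r; exact: h0.
  under eq_bigr do rewrite exprSr -mulrA.
  (* The functions [lam i * h i] keep the eigenvalues [lam i] and again have sum 0. *)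
  apply: (IH (fun i u => lam i * h i u)) => [i|]; first exact: eigenfunZ.
  exact: eigenfun_sum0.
have poly0 (p : {poly R}) : \sum_i p.[lam i] * h i v = 0.
  under eq_bigr do rewrite horner_coef mulr_suml.
  rewrite exchange_big big1//= => n _; under eq_bigr do rewrite -mulrA.
  by rewrite -mulr_sumr pow0 mulr0.
pose p := \prod_(j | lam j != mu) ('X - (lam j)%:P).
have := poly0 p; rewrite (bigID (fun i => lam i == mu))/=.
rewrite [X in _ + X]big1 => [|i hi]; last first.
  by rewrite /p (bigD1 i)//= hornerM hornerXsubC subrr !mul0r.
rewrite (eq_bigr (fun i => p.[mu] * h i v)); last by move=> i /eqP ->.
rewrite addr0 -mulr_sumr => /eqP; rewrite mulf_eq0 => /orP[|/eqP//].
rewrite horner_prod prodf_seq_eq0 => /hasP[j _ /andP[hj]].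
by rewrite hornerXsubC subr_eq0 eq_sym (negbTE hj).
Qed.

(** * Power series with factorially decaying coefficients *)

(** Such a bound gives convergence everywhere, by comparison with the exponential series, and
    survives termwise differentiation with the same [A]. *)
Definition fact_bounded (R : realType) (c : nat -> R) : Prop :=
  exists2 A : R, 0 <= A & forall n, `|c n| <= A / n`!%:R.

Lemma fact_bounded_diffs (R : realType) (c : nat -> R) :
  fact_bounded c -> fact_bounded (pseries_diffs c).
Proof.
move=> [A A0 hA]; exists A => // n; rewrite /pseries_diffs normrM normr_nat.
apply: le_trans (_ : n.+1%:R * (A / n.+1`!%:R) <= _).
  by rewrite ler_wpM2l.
by rewrite factS natrM invfM mulrCA mulVKf// pnatr_eq0.
Qed.

Lemma fact_bounded_cvg (R : realType) (c : nat -> R) (s : R) :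
  fact_bounded c -> cvgn (pseries c s).
Proof.
move=> [A A0 hA]; apply: normed_cvg.
apply: (@series_le_cvg _ _ (A *: exp_coeff `|s|)) => [n|n|n|] //=.
- rewrite /exp_coeff; apply: mulr_ge0 => //.
  by rewrite divr_ge0// exprn_ge0.
- rewrite /exp_coeff /= normrM normrX [leRHS](_ : _ = A / n`!%:R * `|s| ^+ n).
    by rewrite ler_wpM2r// exprn_ge0.
  by rewrite mulrAC -mulrA.
by apply: is_cvg_seriesZ; exact: is_cvg_series_exp_coeff.
Qed.

Lemma fact_boundedZ (R : realType) (a : R) (c : nat -> R) :
  fact_bounded c -> fact_bounded (fun n => a * c n).
Proof.
move=> [A A0 hA]; exists (`|a| * A) => [|n]; first exact: mulr_ge0.
by rewrite normrM -mulrA ler_wpM2l.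
Qed.

Definition psum (R : realType) (c : nat -> R) (s : R) : R := limn (pseries c s).

Lemma is_derive_psum (R : realType) (c : nat -> R) (s : R) :
  fact_bounded c -> is_derive s 1 (psum c) (psum (pseries_diffs c) s).
Proof.
(* Termwise differentiation at [s] requires convergence at some point of larger modulus; [|s| + 1]
   is one. *)
move=> hc; apply: (@pseries_snd_diffs _ _ (`|s| + 1));
  do ?[by apply: fact_bounded_cvg; do ?apply: fact_bounded_diffs].
by rewrite [ltRHS]ger0_norm ?ltrDl// addr_ge0.
Qed.

Lemma psumD (R : realType) (c d : nat -> R) (s : R) :
  cvgn (pseries c s) -> cvgn (pseries d s) ->
  psum (fun n => c n + d n) s = psum c s + psum d s.
Proof.
move=> hc hd; rewrite /psum -lim_seriesD//; congr (limn (series _)).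
by apply/funext => n; rewrite fctE -mulrDl.
Qed.

Lemma psumZ (R : realType) (a : R) (c : nat -> R) (s : R) :
  cvgn (pseries c s) -> psum (fun n => a * c n) s = a * psum c s.
Proof.
move=> hc; rewrite /psum (_ : pseries _ s = a *: pseries c s).
  exact: limZl_tmp hc.
apply/funext => n; rewrite /pseries /series fctE scaler_sumr.
by apply: eq_bigr => i _; rewrite /GRing.scale/= mulrA.
Qed.

(* The two factors [n + 1] come from the two derivatives in [(s f')']. *)
Lemma is_derive_psum_flux (R : realType) (c : nat -> R) (s : R) :
  fact_bounded c ->
  is_derive s 1 (fun t => t * psum (pseries_diffs c) t)
    (psum (fun n => n.+1%:R ^+ 2 * c n.+1) s).
Proof.
move=> hc; have hd := fact_bounded_diffs hc.
apply: is_derive_eq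
  (is_derive1_mul (is_derive_id s 1) (is_derive_psum s hd)) _.
rewrite mulr1; set d := pseries_diffs c.
(* Multiplying by [s] restores the power lost in differentiation; the term n = 0, whose exponent is
   truncated, is 0 on both sides. *)
have hn : (pseries (fun n => n%:R * d n) s @ \oo -->
    s * psum (pseries_diffs d) s)%classic.
  have := @pseries_diffs_equiv R d s (fact_bounded_cvg (fact_bounded_diffs hd)).
  move/(@cvgZl_tmp _ _ _ _ _ s).
  apply: cvg_trans; apply: near_eq_cvg; near=> n.
  rewrite /pseries /series /= scaler_sumr; apply: eq_bigr => -[|i] _.
    by rewrite !mul0r scaler0.
  by rewrite /GRing.scale/= exprS mulrCA.
rewrite -[X in X + _](cvg_lim _ hn)// -[lim _]/(psum _ s) -psumD//.
- congr psum; apply/funext => n; rewrite /d /pseries_diffs; ring.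
- by apply/cvg_ex; eexists; exact: hn.
- exact: fact_bounded_cvg.
Unshelve. all: by end_near. Qed.

(** * Bessel functions as eigenfunctions *)

(* Coefficients of [J0] (for [eps = -1]) and of [I0] (for [eps = 1]) as power
   series in the variable [s = (t / 2) ^ 2]. *)
Definition bessel_coef (R : realType) (eps : R) (n : nat) : R :=
  eps ^+ n / n`!%:R ^+ 2.

(** Up to sign, the series that accompanies the logarithm in [Y0] and [K0]; [series harmonic n] is
    the harmonic number H_n. *)
Definition bessel_log_coef (R : realType) (eps : R) (n : nat) : R :=
  eps ^+ n * series harmonic n / n`!%:R ^+ 2.

Lemma bessel_coef_bounded (R : realType) (eps : R) :
  `|eps| <= 1 -> fact_bounded (bessel_coef eps).
Proof.
move=> he; exists 1 => // n; rewrite /bessel_coef normrM normrX ler_pM//.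
  by rewrite exprn_ile1.
have n0 : 1 <= n`!%:R :> R by rewrite ler1n fact_gt0.
rewrite ger0_norm ?invr_ge0// lef_pV2 ?posrE ?exprn_gt0 ?ltr0n ?fact_gt0//.
by rewrite expr2 ler_peMl.
Qed.

Lemma bessel_log_coef_bounded (R : realType) (eps : R) :
  `|eps| <= 1 -> fact_bounded (bessel_log_coef eps).
Proof.
move=> he; exists 1 => // n; rewrite /bessel_log_coef.
(* H_n <= n! uses up one of the two factorials in the denominator. *)
have hH : 0 <= series (@harmonic R) n <= n`!%:R.
  elim: n => [|n /andP[IH0 IH]]; first by rewrite /series/= big_geq// lexx ler01.
  rewrite seriesSr; apply/andP; split; first by rewrite addr_ge0// harmonic_ge0.
  case: n IH0 IH => [|n] IH0 IH.
    by rewrite /series/= big_geq// add0r /harmonic/= invr1.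
  rewrite factS natrM -natr1 mulrDl mul1r addrC lerD//.
  apply: le_trans (_ : 1 <= _); first by rewrite invf_le1// ler1n.
  by rewrite -natrM ler1n muln_gt0 fact_gt0.
have f0 : 0 < n`!%:R :> R by rewrite ltr0n fact_gt0.
case/andP: hH => h0 h1.
rewrite normrM [X in _ * X]ger0_norm ?invr_ge0 ?exprn_ge0//.
rewrite ler_pdivrMr ?exprn_gt0// expr2 mulrA divfK ?gt_eqF// mul1r.
rewrite normrM normrX (ger0_norm h0).
by rewrite (le_trans _ h1)// ler_piMl// exprn_ile1.
Qed.

(** The equation (s f')' = eps f, coefficient by coefficient. *)
Lemma bessel_coefS (R : realType) (eps : R) (n : nat) :
  n.+1%:R ^+ 2 * bessel_coef eps n.+1 = eps * bessel_coef eps n.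
Proof.
rewrite /bessel_coef factS natrM (exprS eps); field.
by rewrite nat1r !pnatr_eq0 -!lt0n fact_gt0.
Qed.

(** The increment 1/(n+1) of H_n produces the extra term, which makes the log series satisfy (s g')'
    = eps g + f'. *)
Lemma bessel_log_coefS (R : realType) (eps : R) (n : nat) :
  n.+1%:R ^+ 2 * bessel_log_coef eps n.+1 =
  eps * bessel_log_coef eps n + pseries_diffs (bessel_coef eps) n.
Proof.
rewrite /pseries_diffs /bessel_log_coef /bessel_coef seriesSr /harmonic/=.
rewrite factS natrM (exprS eps); field.
by rewrite nat1r !pnatr_eq0 -!lt0n fact_gt0.
Qed.

Lemma is_derive_bessel_flux (R : realType) (eps s : R) : `|eps| <= 1 ->
  is_derive s 1 (fun t => t * psum (pseries_diffs (bessel_coef eps)) t)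
    (eps * psum (bessel_coef eps) s).
Proof.
move=> he; have hc := bessel_coef_bounded he.
apply: is_derive_eq (is_derive_psum_flux s hc) _.
rewrite -psumZ; last exact: fact_bounded_cvg.
by congr psum; apply/funext => n; exact: bessel_coefS.
Qed.

Lemma is_derive_bessel_log_flux (R : realType) (eps s : R) : `|eps| <= 1 ->
  is_derive s 1 (fun t => t * psum (pseries_diffs (bessel_log_coef eps)) t)
    (eps * psum (bessel_log_coef eps) s
     + psum (pseries_diffs (bessel_coef eps)) s).
Proof.
move=> he; have hc := bessel_log_coef_bounded he.
have hd := fact_bounded_diffs (bessel_coef_bounded he).
have hl := fact_bounded_cvg (s := s) hc.
apply: is_derive_eq (is_derive_psum_flux s hc) _.
rewrite -psumZ// -psumD.
- by congr psum; apply/funext => n; exact: bessel_log_coefS.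
- exact/fact_bounded_cvg/fact_boundedZ.
- exact: fact_bounded_cvg.
Qed.

(* With [s = (t / 2) ^ 2] this is [pi / 2 * Y0 t] for [eps = -1] and [- K0 t] for
   [eps = 1]. *)
Definition bessel_second (R : realType) (eps s : R) : R :=
  (2^-1 * ln s + euler_gamma R) * psum (bessel_coef eps) s
  - psum (bessel_log_coef eps) s.

Lemma eigenfun_bessel (R : realType) (a b eps : R) : 0 <= a -> `|eps| <= 1 ->
  eigenfun a b eps (psum (bessel_coef eps)).
Proof.
move=> a0 he; exists (fun t => t * psum (pseries_diffs (bessel_coef eps)) t).
move=> v /andP[av _]; split; last exact: is_derive_bessel_flux.
rewrite mulrAC divff ?mul1r ?gt_eqF ?(le_lt_trans a0)//.
exact/is_derive_psum/bessel_coef_bounded.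
Qed.

(** Differentiating the flux, the logarithm yields f'/2 twice, once from its own derivative and once
    from the term f/2; together they cancel the f' in the equation of the log series. *)
Lemma eigenfun_bessel_second (R : realType) (a b eps : R) :
  0 <= a -> `|eps| <= 1 -> eigenfun a b eps (bessel_second eps).
Proof.
move=> a0 he.
have hc := bessel_coef_bounded he; have hl := bessel_log_coef_bounded he.
pose f := psum (bessel_coef eps).
pose f' := psum (pseries_diffs (bessel_coef eps)).
pose g' := psum (pseries_diffs (bessel_log_coef eps)).
exists (fun t => (2^-1 * ln t + euler_gamma R) * (t * f' t)
  + 2^-1 * f t - t * g' t).
move=> v /andP[av _]; have v0 : 0 < v := le_lt_trans a0 av.
have dL : is_derive v 1 (fun t => 2^-1 * ln t + euler_gamma R) (2^-1 * v^-1).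
  apply: is_derive_eq (is_deriveD (is_deriveZ 2^-1 (is_derive1_ln v0))
    (is_derive_cst (euler_gamma R) v 1)) _.
  by rewrite addr0.
split.
  apply: is_derive_eq (is_deriveB (is_derive1_mul dL (is_derive_psum v hc))
    (is_derive_psum v hl)) _.
  by rewrite -/f -/f' -/g'; field; rewrite gt_eqF.
apply: is_derive_eq (is_deriveB (is_deriveD
   (is_derive1_mul dL (is_derive_bessel_flux v he))
   (is_deriveZ 2^-1 (is_derive_psum v hc))) (is_derive_bessel_log_flux v he)) _.
rewrite /bessel_second -/f -/f' /GRing.scale/=.
by field; rewrite gt_eqF.
Qed.

Lemma psum_bessel0 (R : realType) (eps : R) : psum (bessel_coef eps) 0 = 1.
Proof.
rewrite /psum; apply: lim_near_cst => //; near=> n.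
have n0 : (0 < n)%N by near: n; exact: nbhs_infty_gt.
rewrite /pseries /series /= -(prednK n0) big_nat_recl// big1 => [|i _].
  by rewrite addr0 /bessel_coef !expr0 fact0 expr1n divr1 mul1r.
by rewrite expr0n mulr0.
Unshelve. all: by end_near. Qed.

Lemma is_derive_ge0_le (R : realType) (h dh : R -> R) (a b : R) :
  (forall v : R, is_derive v 1 h (dh v)) ->
  (forall v, a < v < b -> 0 <= dh v) -> a <= b -> h a <= h b.
Proof.
move=> hd h0 ab; apply: (@ger0_derive1_le_cc _ h a b).
- by move=> v _; case: (hd v).
- by move=> v; rewrite in_itv/= derive1E (derive_val (is_derive := hd v)) => /h0.
- by apply: derivable_within_continuous => v _; case: (hd v).
- by rewrite in_itv/= lexx.
- by rewrite in_itv/= lexx andbT.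
- exact: ab.
Qed.

(* Energy argument: for [f = J0] in the variable [s], the function
   [s f^2 + (s f')^2] has derivative [f^2 >= 0]; it is nonnegative, so if it
   vanished at a point then [f] would vanish everywhere to the left of it. *)
Lemma bessel_neq0 (R : realType) (a b : R) : 0 <= a < b ->
  exists2 v, a < v < b & psum (bessel_coef (-1)) v != 0.
Proof.
case/andP=> a0 ab; apply: contrapT => hn.
have he : `|-1 : R| <= 1 by rewrite normrN1.
pose f := psum (bessel_coef (-1 : R)).
pose f' := psum (pseries_diffs (bessel_coef (-1 : R))).
have f0 v : a < v < b -> f v = 0.
  by move=> hv; apply/eqP/negPn/negP => fv; apply: hn; exists v.
have df (v : R) : is_derive v 1 f (f' v) by exact/is_derive_psum/bessel_coef_bounded.
have dw (v : R) : is_derive v 1 (fun t => t * f' t) (- f v).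
  by apply: is_derive_eq (is_derive_bessel_flux v he) _; rewrite mulN1r.
pose c := (a + b) / 2; have hc : a < c < b by rewrite /c; lra.
have c0 : 0 < c by case/andP: hc => /(le_lt_trans a0).
have f'c : f' c = 0 by exact: is_derive_eq0_itv f0 hc (df c).
pose G t := t * (f t * f t) + (t * f' t) * (t * f' t).
have dG (v : R) : is_derive v 1 G (f v * f v).
  apply: is_derive_eq (is_deriveD
    (is_derive1_mul (is_derive_id v 1) (is_derive1_mul (df v) (df v)))
    (is_derive1_mul (dw v) (dw v))) _.
  by ring.
have G0 v : 0 <= v <= c -> G v = 0.
  case/andP=> v0 vc; apply/eqP; rewrite eq_le; apply/andP; split; last first.
    by rewrite /G -!expr2 addr_ge0 ?sqr_ge0 // mulr_ge0 ?sqr_ge0.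
  have -> : 0 = G c by rewrite /G f0// f'c !mulr0 addr0.
  apply: (is_derive_ge0_le dG) => // u; by rewrite -expr2 sqr_ge0.
have fz v : 0 < v < c -> f v = 0.
  case/andP=> v0 vc; have := G0 v; rewrite !ltW// => /(_ isT) /eqP.
  rewrite /G -!expr2 paddr_eq0 ?sqr_ge0//;
    last by rewrite mulr_ge0 ?sqr_ge0 ?ltW.
  by rewrite mulf_eq0 (gt_eqF v0)/= sqrf_eq0 => /andP[/eqP].
have d0 : 0 < c / 2 by rewrite divr_gt0.
have dc : c / 2 < c by rewrite ltr_pdivrMr// ltr_pMr// ltr1n.
(* The vanishing derivative carries the value 0 back to the origin, where the series equals 1. *)
have : f 0 <= f (c / 2).
  apply: (is_derive_ge0_le df) => [u /andP[u0 uc]|]; last exact: ltW.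
  by rewrite (is_derive_eq0_itv fz _ (df u))// u0 (lt_trans uc).
by rewrite [f 0]psum_bessel0 fz ?d0// ler10.
Qed.

Lemma half_ln_sqr (R : realType) (t : R) : 0 < t -> 2^-1 * ln (t ^+ 2) = ln t.
Proof.
by move=> t0; rewrite lnXn// mulr2n; field.
Qed.

Lemma besselY0E (R : realType) (t : R) : 0 < t ->
  besselY0 t = 2 / pi * bessel_second (-1) ((t / 2) ^+ 2).
Proof.
move=> t0; rewrite /besselY0 /bessel_second half_ln_sqr ?divr_gt0//.
congr (_ * (_ + _)); rewrite -[- psum _ _]mulN1r -psumZ; last first.
  by apply/fact_bounded_cvg/bessel_log_coef_bounded; rewrite normrN1.
by congr psum; apply/funext => n; rewrite /bessel_log_coef exprS -!mulrA.
Qed.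

Lemma besselK0E (R : realType) (t : R) : 0 < t ->
  besselK0 t = - bessel_second 1 ((t / 2) ^+ 2).
Proof.
move=> t0; rewrite /besselK0 /bessel_second half_ln_sqr ?divr_gt0//.
rewrite opprB addrC mulNr; congr (_ - _ * _).
  by congr psum; apply/funext => n; rewrite /bessel_log_coef expr1n mul1r.
by congr psum; apply/funext => n; rewrite /bessel_coef expr1n mul1r.
Qed.

(** * Separating the distances seen from one sensor *)

Lemma bessel_distance_split (R : realType) (kmin kmax : R) (I : finType)
    (d al be : I -> R) :
  0 <= kmin -> (forall i, 0 < d i) ->
  (forall k, kmin < k < kmax ->
    \sum_i (al i * besselJ0 (k * d i)
      - be i * (besselY0 (k * d i) + 2 / pi * besselK0 (k * d i))) = 0) ->
  forall r k, 0 < r -> kmin < k < kmax ->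
    (\sum_(i | d i == r) al i) * besselJ0 (k * r)
    - (\sum_(i | d i == r) be i) * besselY0 (k * r) = 0.
Proof.
move=> k0 d0 hsum r k r0 hk.
pose e i : R := (d i / 2) ^+ 2.
have e0 i : 0 < e i by rewrite exprn_gt0// divr_gt0.
(* Each source counts twice: [inl i] carries its [J0] and [Y0] terms with eigenvalue [- e i],
   [inr i] its [K0] term with eigenvalue [e i]. *)
pose lam (i : I + I) := match i with inl i => e i * -1 | inr i => e i * 1 end.
pose h (i : I + I) v := match i with
  | inl i => al i * psum (bessel_coef (-1)) (e i * v)
             + (- be i * (2 / pi)) * bessel_second (-1) (e i * v)
  | inr i => (be i * (2 / pi)) * bessel_second 1 (e i * v) end.
have hN1 : `|-1 : R| <= 1 by rewrite normrN1.
have h1 : `|1 : R| <= 1 by rewrite normr1.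
have arg i (u : R) : (u * d i / 2) ^+ 2 = e i * u ^+ 2 by rewrite /e; field.
have he i : eigenfun (kmin ^+ 2) (kmax ^+ 2) (lam i) (h i).
  have ke j : 0 <= e j * kmin ^+ 2 by rewrite mulr_ge0 ?sqr_ge0// ltW.
  case: i => i /=; last first.
    by apply: eigenfunZ; apply: eigenfun_scale => //;
      exact: eigenfun_bessel_second.
  apply: eigenfunD; apply: eigenfunZ; apply: eigenfun_scale => //.
    exact: eigenfun_bessel.
  exact: eigenfun_bessel_second.
have hh u : 0 < u ->
  (forall i, al i * besselJ0 (u * d i) - be i * besselY0 (u * d i)
     = h (inl i) (u ^+ 2)) /\
  (forall i, - be i * (2 / pi * besselK0 (u * d i)) = h (inr i) (u ^+ 2)).
  move=> u0; split=> i /=.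
    rewrite besselY0E ?mulr_gt0// arg; congr (_ + _); last by rewrite !mulNr mulrA.
    by rewrite /besselJ0 arg.
  by rewrite besselK0E ?mulr_gt0// arg; ring.
have h0 v : kmin ^+ 2 < v < kmax ^+ 2 -> \sum_i h i v = 0.
  case/andP=> kv vk; pose u := Num.sqrt v.
  have v0 : 0 < v by apply: le_lt_trans kv; rewrite sqr_ge0.
  have vE : v = u ^+ 2 by rewrite sqr_sqrtr// ltW.
  have u0 : 0 < u by rewrite sqrtr_gt0.
  have kmax0 : 0 <= kmax.
    by case/andP: hk => h1' h2'; rewrite (le_trans k0)// ltW// (lt_trans h1').
  have hu : kmin < u < kmax.
    by move: kv vk; rewrite vE !ltr_pXn2r ?nnegrE ?(ltW u0)// => -> ->.
  rewrite big_sumType/= vE; have [hl hr] := hh _ u0.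
  under eq_bigr do rewrite -/(h (inl _) _) -hl.
  under [X in _ + X]eq_bigr do rewrite -/(h (inr _) _) -hr.
  rewrite -big_split/=; apply: etrans (hsum _ hu); apply: eq_bigr => i _; ring.
have kpos : 0 < k by case/andP: hk => /(le_lt_trans k0).
(* This eigenvalue is negative, so no [K0] term belongs to it, and the remaining indices are those
   with [d i = r]. *)
have := eigenfun_indep (sqr_ge0 _) he h0 (- (r / 2) ^+ 2) (v := k ^+ 2).
case/andP: (hk) => hk1 hk2; rewrite !ltr_pXn2r ?nnegrE ?(ltW kpos)//;
  last first.
  by rewrite (le_trans (ltW kpos))// ltW.
rewrite hk1 hk2 => /(_ isT); rewrite big_sumType/=.
rewrite [X in _ + X]big1 ?addr0 => [|i]; last first.
  move/eqP=> hi; have := e0 i; rewrite -[e i]mulr1 hi oppr_gt0 ltNge.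
  by rewrite sqr_ge0.
move=> hz; rewrite !mulr_suml -sumrB; apply: etrans hz.
rewrite [RHS](eq_bigl (fun i => d i == r)) => [|i].
  by apply: eq_bigr => i /eqP <-; rewrite (hh _ kpos).1.
rewrite mulrN1 eqr_opp /e eqrXn2 ?divr_ge0 ?ltW//.
by rewrite (inj_eq (mulIf _))// invr_eq0 pnatr_eq0.
Qed.

Lemma Re_sum (R : realType) (I : finType) (P : pred I) (f : I -> R[i]) :
  complex.Re (\sum_(i | P i) f i) = \sum_(i | P i) complex.Re (f i).
Proof. by apply: big_morph => // -[a b] [c d]. Qed.

Lemma Im_sum (R : realType) (I : finType) (P : pred I) (f : I -> R[i]) :
  complex.Im (\sum_(i | P i) f i) = \sum_(i | P i) complex.Im (f i).
Proof. by apply: big_morph => // -[a b] [c d]. Qed.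

(* The parenthesis in the definition of [Phi], as a function of [k |x - y|]. *)
Definition radial (R : realType) (t : R) : R[i] :=
  hankel0 t + (2 * 'i%C) / pi%:C * (besselK0 t)%:C.

Lemma radialE (R : realType) (t : R) :
  radial t = (besselJ0 t +i* (besselY0 t + 2 / pi * besselK0 t)).
Proof.
rewrite /radial /hankel0 -(rmorph_nat (real_complex R) 2) -fmorphV.
by apply/eqP; rewrite eq_complex /=; apply/andP; split; apply/eqP; ring.
Qed.

(** Real and imaginary parts of the data give two real systems for [bessel_distance_split]. For the
    total strength A + iB at distance r they say (A + iB)(J0 + iY0) = 0 at kr. *)
Lemma radial_distance_indep (R : realType) (kmin kmax : R) (I : finType)
    (d : I -> R) (c : I -> R[i]) :
  0 <= kmin -> kmin < kmax -> (forall i, 0 < d i) ->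
  (forall k, kmin < k < kmax -> \sum_i c i * radial (k * d i) = 0) ->
  forall r, \sum_(i | d i == r) c i = 0.
Proof.
move=> k0 k1 d0 hsum r.
have [r0|r0] := ltP 0 r; last first.
  by rewrite big1// => i /eqP hi; move: (d0 i); rewrite hi ltNge r0.
pose A := \sum_(i | d i == r) complex.Re (c i).
pose B := \sum_(i | d i == r) complex.Im (c i).
have h1 k : kmin < k < kmax -> A * besselJ0 (k * r) - B * besselY0 (k * r) = 0.
  apply: (bessel_distance_split k0 d0) => // u hu.
  have := congr1 (@complex.Re R) (hsum u hu); rewrite Re_sum => /=.
  move=> h; apply: etrans h; apply: eq_bigr => i _; rewrite radialE.
  by case: (c i) => a b /=; ring.
have h2 k : kmin < k < kmax -> B * besselJ0 (k * r) + A * besselY0 (k * r) = 0.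
  move=> hk; rewrite -[A]opprK mulNr -sumrN.
  apply: (bessel_distance_split k0 d0 (al := fun i => complex.Im (c i))
    (be := fun i => - complex.Re (c i)) _ r0 hk) => u hu.
  have := congr1 (@complex.Im R) (hsum u hu); rewrite Im_sum => /=.
  move=> h; apply: etrans h; apply: eq_bigr => i _; rewrite radialE.
  by case: (c i) => a b /=; ring.
(* A nonzero value of the series at v is taken back to the wave number through v = (k r / 2)^2. *)
have [k hk J0] : exists2 k, kmin < k < kmax & besselJ0 (k * r) != 0.
  have [|v hv hJ] := @bessel_neq0 R ((kmin * r / 2) ^+ 2) ((kmax * r / 2) ^+ 2).
    rewrite sqr_ge0 ltr_pXn2r ?nnegrE ?divr_ge0 ?mulr_ge0 ?(ltW r0)
      ?(le_trans k0 (ltW k1))//.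
    by rewrite ltr_pM2r ?invr_gt0// ltr_pM2r.
  have v0 : 0 < v by case/andP: hv => + _; apply: le_lt_trans; exact: sqr_ge0.
  pose s := Num.sqrt v; have s0 : 0 < s by rewrite sqrtr_gt0.
  have vE : v = s ^+ 2 by rewrite sqr_sqrtr// ltW.
  have hs : 2 * s / r * r = 2 * s by rewrite divfK ?gt_eqF.
  exists (2 * s / r); last first.
    rewrite /besselJ0 hs [2 * s]mulrC mulfK ?pnatr_eq0// -vE; exact: hJ.
  move: hv; rewrite vE !ltr_pXn2r ?nnegrE ?divr_ge0 ?mulr_ge0 ?(ltW r0)
    ?(ltW s0) ?(le_trans k0 (ltW k1))//.
  by rewrite ltr_pdivlMr// ltr_pdivrMr// ltr_pdivrMr// ltr_pdivlMr// ![_ * 2]mulrC.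
(* This combination of the two equations eliminates [Y0]. *)
have AB : (A ^+ 2 + B ^+ 2) * besselJ0 (k * r) = 0.
  transitivity (A * (A * besselJ0 (k * r) - B * besselY0 (k * r))
    + B * (B * besselJ0 (k * r) + A * besselY0 (k * r))); first by ring.
  by rewrite h1// h2// !mulr0 addr0.
move/eqP: AB; rewrite mulf_eq0 (negbTE J0) orbF paddr_eq0 ?sqr_ge0//.
rewrite !sqrf_eq0 => /andP[/eqP A0 /eqP B0].
apply/eqP; rewrite eq_complex Re_sum Im_sum -/A -/B A0 B0 /=.
by rewrite eqxx.
Qed.

(** * Bisectors and counting of fibers *)

Lemma edist_gt0 (R : realType) (x y : 'rV[R]_2) : x != y -> 0 < Defs.edist x y.
Proof.
move=> xy; rewrite sqrtr_gt0 lt0r sumr_ge0 ?andbT => [|i _]; last exact: sqr_ge0.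
apply: contraNN xy; rewrite psumr_eq0 => [/allP h|i _]; last exact: sqr_ge0.
apply/eqP/rowP => i; apply/eqP; rewrite -subr_eq0 -sqrf_eq0.
by apply: h; rewrite mem_index_enum.
Qed.

(** The squares of x cancel in the equality of squared distances, leaving x - (p + q)/2 orthogonal
    to p - q. The line runs through the midpoint along p - q turned by a right angle. *)
Lemma bisector_on_line (R : realType) (p q : 'rV[R]_2) : p != q ->
  exists a v : 'rV[R]_2, v != 0 /\
    forall x, Defs.edist x p = Defs.edist x q -> on_line a v x.
Proof.
move=> pq.
pose w i := p 0 i - q 0 i.
pose D := w 0 ^+ 2 + w 1 ^+ 2.
have D0 : D != 0.
  apply: contraNN pq; rewrite /D paddr_eq0 ?sqr_ge0// !sqrf_eq0 !subr_eq0.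
  case/andP=> /eqP h0 /eqP h1; apply/eqP/rowP => i.
  have : i = 0 \/ i = 1 by case: i => -[|[|[]]]// ?; [left|right]; apply/val_inj.
  by case=> ->.
pose v : 'rV[R]_2 := \row_i (if i == 0 then - w 1 else w 0).
exists (2^-1 *: (p + q)), v; split.
  apply: contraNN D0 => /eqP/rowP v0.
  have := v0 0; have := v0 1; rewrite !mxE/= /D => -> /eqP.
  by rewrite oppr_eq0 => /eqP ->; rewrite expr0n addr0.
move=> x hx.
have {hx} : \sum_(i < 2) (x 0 i - p 0 i) ^+ 2 =
    \sum_(i < 2) (x 0 i - q 0 i) ^+ 2.
  have s0 y : 0 <= \sum_(i < 2) (x 0 i - y 0 i) ^+ 2.
    by rewrite sumr_ge0// => i _; exact: sqr_ge0.
  by have := congr1 (fun u => u ^+ 2) hx; rewrite !sqr_sqrtr.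
have l01 : lift ord0 ord0 = 1 :> 'I_2 by exact/val_inj.
rewrite !big_ord_recl !big_ord0 !addr0 l01 => hx.
pose y i := x 0 i - 2^-1 * (p 0 i + q 0 i).
have hy : y 0 * w 0 + y 1 * w 1 = 0 by rewrite /y /w; move: hx; lra.
(* The parameter is the inner product of [y] with [v], divided by the squared length [D] of [v]. *)
exists ((y 1 * w 0 - y 0 * w 1) / D); apply/rowP => i; rewrite !mxE.
have div u z : u * D = z -> u = z / D by move=> <-; rewrite mulfK.
apply/eqP; rewrite [eqbRHS]addrC -subr_eq -/(y i) mulrAC; apply/eqP/div.
have : i = 0 \/ i = 1 by case: i => -[|[|[]]]// ?; [left|right]; apply/val_inj.
case=> -> /=; rewrite /D.
  transitivity ((y 1 * w 0 - y 0 * w 1) * - w 1 +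
    (y 0 * w 0 + y 1 * w 1) * w 0); first by ring.
  by rewrite hy mul0r addr0.
transitivity ((y 1 * w 0 - y 0 * w 1) * w 0 +
  (y 0 * w 0 + y 1 * w 1) * w 1); first by ring.
by rewrite hy mul0r addr0.
Qed.

Lemma card_fibers_le2 (I J : finType) (g : I -> J) (P : pred J) :
  (forall i, P (g i)) ->
  (forall i1 i2 i3, i1 != i2 -> i2 != i3 -> i1 != i3 ->
     g i1 = g i2 -> g i1 = g i3 -> False) ->
  (#|I| <= 2 * #|P|)%N.
Proof.
move=> gP g3; rewrite -[#|I|]sum1_card (partition_big g P) //= mulnC -sum_nat_const.
apply: leq_sum => j _; rewrite sum1_card leqNgt; apply/negP.
case/card_gt2P=> i1 [i2 [i3 [[/eqP h1 /eqP h2 /eqP h3] [n12 n23 n31]]]].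
by apply: (g3 i1 i2 i3) => //; rewrite 1?eq_sym// h1 ?h2 ?h3.
Qed.

(** * Cancellation of strengths and matching of configurations *)

Lemma strength_eq0 (R : realType) (L : nat) (x : 'I_L -> 'rV[R]_2) (I : finType)
    (p : I -> 'rV[R]_2) (c : I -> R[i]) :
  injective x -> no_three_collinear x -> (2 * #|I| - 2 < L)%N ->
  (forall l r, \sum_(i | Defs.edist (x l) (p i) == r) c i = 0) ->
  forall q, \sum_(i | p i == q) c i = 0.
Proof.
move=> xinj hcol hL hc q; apply/eqP/negPn/negP => hq.
have [i0 hi0] : exists i0, p i0 == q.
  apply/existsP; apply: contraNT hq; rewrite negb_exists => /forallP h.
  by rewrite big_pred0// => i; exact/negbTE.
(* Otherwise the sum at this distance from sensor [l] would consist of the terms at [q] alone, whose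
   sum is nonzero. *)
have /choice[g hg] : forall l, exists i,
    p i != q /\ Defs.edist (x l) (p i) = Defs.edist (x l) q.
  move=> l; apply: contrapT => hn; move/negP: hq; apply.
  apply/eqP; apply: etrans (hc l (Defs.edist (x l) q)); apply: eq_bigl => i.
  apply/eqP/eqP => [->//|hi]; apply/eqP/negPn/negP => hp.
  by apply: hn; exists i.
have : (#|'I_L| <= 2 * #|[pred i | p i != q]|)%N.
  apply: (@card_fibers_le2 _ _ g) => [l|l1 l2 l3 n12 n23 n13 g12 g13].
    by have [] := hg l.
  have [gq e1] := hg l1; have [a [v [v0 hv]]] := bisector_on_line gq.
  apply: (hcol l1 l2 l3) => //; exists a, v; split => //; apply: hv => //.
    by rewrite g12; case: (hg l2).
  by rewrite g13; case: (hg l3).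
rewrite card_ord => hL2.
(* The index [i0] sits at [q], so at most [#|I| - 1] bisectors are available. *)
have : (#|[pred i | p i != q]| < #|I|)%N.
  apply/proper_card/properP; split; first exact/fintype.subsetP.
  by exists i0; rewrite ?inE// hi0.
by move: hL hL2; lia.
Qed.

(** At [q = z m] the left sum is the single nonzero term [tau m], so the right sum is not empty, and
    by injectivity it too has one term. *)
Lemma strength_match (R : realType) (M M' : nat)
    (z : 'I_M -> 'rV[R]_2) (tau : 'I_M -> R[i])
    (z' : 'I_M' -> 'rV[R]_2) (tau' : 'I_M' -> R[i]) :
  injective z -> injective z' -> (forall m, tau m != 0) ->
  (forall q, \sum_(m | z m == q) tau m = \sum_(m | z' m == q) tau' m) ->
  forall m, exists m', z' m' = z m /\ tau' m' = tau m.
Proof.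
move=> zinj z'inj tau0 hq m; have := hq (z m).
rewrite (big_pred1 m) => [hm|i]; last by rewrite /= (inj_eq zinj).
have [m' /eqP zm'] : exists m', z' m' == z m.
  apply/existsP; apply: contraNT (tau0 m); rewrite negb_exists => /forallP h.
  by rewrite hm big_pred0// => i; exact/negbTE.
exists m'; split => //; rewrite hm (big_pred1 m')// => i.
by rewrite /= -zm' (inj_eq z'inj).
Qed.

Theorem theorem3p2 (R : realType) (kmin kmax : R)
  (hkmin : 0 <= kmin) (hk : kmin < kmax)
  (L : nat) (x : 'I_L -> 'rV[R]_2)
  (hx : injective x) (hcol : no_three_collinear x)
  (M : nat) (z : 'I_M -> 'rV[R]_2) (tau : 'I_M -> R[i])
  (M' : nat) (z' : 'I_M' -> 'rV[R]_2) (tau' : 'I_M' -> R[i])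
  (hM : source_config x z tau) (hM' : source_config x z' tau')
  (heq : forall (l : 'I_L) (k : R), kmin < k < kmax ->
     scattered z tau (x l) k = scattered z' tau' (x l) k) :
  exists (e : M = M') (s : 'S_M),
    forall m : 'I_M,
      z' (cast_ord e m) = z (s m) /\ tau' (cast_ord e m) = tau (s m).
Proof.
case: hM hM' => [M0 zinj zx tau0 ML] [M'0 z'inj z'x tau'0 M'L].
(* The two configurations are merged into one family, the second with opposite strengths, so that
   its field vanishes at the sensors. Points of the two may coincide, hence the sums over equal
   positions. *)
pose p (i : 'I_M + 'I_M') := match i with inl m => z m | inr m => z' m end.
pose c (i : 'I_M + 'I_M') := match i with inl m => tau m | inr m => - tau' m end.
have hc l r : \sum_(i | Defs.edist (x l) (p i) == r) c i = 0.
  apply: (radial_distance_indep hkmin hk (d := fun i => Defs.edist (x l) (p i))).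
    by case=> m; apply: edist_gt0; rewrite eq_sym; [exact: zx|exact: z'x].
  move=> k hkk; have k0 : 0 < k by case/andP: hkk => /(le_lt_trans hkmin).
  pose C : R[i] := 'i%C / (8 * k ^+ 2)%:C.
  have C0 : C != 0.
    rewrite mulf_neq0 ?invr_eq0//; first exact: neq0Ci.
    by rewrite fmorph_eq0 mulf_neq0// ?pnatr_eq0// expf_neq0// gt_eqF.
  apply: (mulfI C0); rewrite mulr0 big_sumType/= mulrDr !mulr_sumr.
  have /eqP := heq l k hkk; rewrite -subr_eq0 => /eqP h; apply: etrans h.
  rewrite /scattered -sumrN; congr (_ + _); apply: eq_bigr => m _.
    by rewrite mulrCA.
  by rewrite mulNr mulrN mulrCA.
have hq q : \sum_(m | z m == q) tau m = \sum_(m | z' m == q) tau' m.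
  have := strength_eq0 hx hcol _ hc q.
  rewrite card_sum !card_ord big_sumType/= sumrN => h.
  (* Averaging the two bounds on [L] gives 2(M + M') - 1 <= L. *)
  by apply/eqP; rewrite -subr_eq0 h//; move: M0 M'0 ML M'L; lia.
have /choice[f hf] := strength_match zinj z'inj tau0 hq.
have /choice[g hg] := strength_match z'inj zinj tau'0 (fun q => esym (hq q)).
have finj : injective f.
  by move=> m1 m2 e; apply: zinj; rewrite -(hf m1).1 -(hf m2).1 e.
have ginj : injective g.
  by move=> m1 m2 e; apply: z'inj; rewrite -(hg m1).1 -(hg m2).1 e.
have e : M = M'.
  have := leq_card _ finj; have := leq_card _ ginj; rewrite !card_ord => h1 h2.
  by apply/eqP; rewrite eqn_leq h1 h2.
(* [g] sends each source of the second configuration to its equal in the first; the cast makes it an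
   injective self-map of ['I_M]. *)
have sinj : injective (g \o cast_ord e) := inj_comp ginj (@cast_ord_inj _ _ e).
by exists e, (perm sinj) => m; rewrite permE/=; have [-> ->] := hg (cast_ord e m).
Qed.
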